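(* Let $1\le p<\infty$ and let $\mathcal{C}=(c_{j,k})_{j,k\in\mathbb{Z}}$ be a matrix with $c_{j,k}=c_{k,j}\ge0$ and $c_{j,j}=0$, such that $\mathcal{S}_0\subset\mathcal{B}^p(\mathcal{C})$ and $x\mapsto\|x\|_{\mathcal{B}^p(\mathcal{C})}$ is a norm on $\mathcal{S}_0$. The following statements hold. (1) Let $\lambda=(\lambda_j)_{j\in\mathbb{Z}}$ be a sequence of complex numbers. Then $$\lambda\in\mathrm{Mult}(\mathcal{B}_0^p(c_{j,k}))\iff \lambda\in l^\infty(\mathbb{Z})\ \text{ and }\ \sum_{k}|x_k|^p\mu_k^p\le C^p\|x\|^p_{\mathcal{B}^p},\quad\forall x\in\mathcal{B}_0^p(c_{j,k}),$$ where $\mu_k^p=\mu_k^p(\lambda):=\sum_{j}c_{j,k}|\lambda_j-\lambda_k|^p$ and $C$ is a positive constant (independent of $x$). In particular, $\mathrm{Mult}(\mathcal{B}_0^p(c_{j,k}))$ obeys the Spectral Localization Property (that is, $\sigma(T_\lambda)=\mathrm{clos}\{\lambda_j: j\in\mathbb{Z}\}$ for every $\lambda\in\mathrm{Mult}(\mathcal{B}_0^p(c_{j,k}))$; equivalently, if $\lambda$ is a multiplier and $\inf_j|\lambda_j|>0$, then $1/\lambda=(1/\lambda_j)_{j\in\mathbb{Z}}$ is a multiplier), and $$\|T_{1/\lambda}\|\le\delta^{-2}\big(\|T_\lambda\|+\|\lambda\|_{\infty}\big)+\delta^{-1},\qquad\text{where }\delta=\inf_j|\lambda_j|>0.$$ (2)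 If $C=C(\lambda)$ is the best possible constant in (1), then $$C(\lambda)-\|\lambda\|_{l^\infty}\le\|T_\lambda\|\le C(\lambda)+\|\lambda\|_{l^\infty}.$$
   Context: $\mathcal{S}_0=\mathrm{Lin}(e_n:n\in\mathbb{Z})$ is the space of finitely supported complex sequences on $\mathbb{Z}$, where $e_n=(\delta_{nj})_{j\in\mathbb{Z}}$. $\mathcal{B}^p(\mathcal{C})=\mathcal{B}^p(c_{j,k})$ is the space of complex sequences $x=(x_j)_{j\in\mathbb{Z}}$ with $\|x\|^p=\|x\|^p_{\mathcal{B}^p}=\|x\|^p_{\mathcal{B}^p(\mathcal{C})}=\sum_{j,k}c_{j,k}|x_j-x_k|^p<\infty$, equipped with this (semi)norm. $\mathcal{B}_0^p(c_{j,k})$ is the closed linear span of $\{e_n:n\in\mathbb{Z}\}$ in $\mathcal{B}^p(c_{j,k})$ or, better, the completion of $(\mathcal{S}_0,\|\cdot\|)$. $\mathrm{Mult}(\mathcal{B}_0^p(c_{j,k}))$ is the set of complex sequences $\lambda=(\lambda_j)_{j\in\mathbb{Z}}$ such that the linear map $T_\lambda:e_n\mapsto\lambda_ne_n$ $(n\in\mathbb{Z})$ extends to a bounded operator on $\mathcal{B}_0^p(c_{j,k})$; $\|T_\lambda\|$ is its operator norm and $\sigma(T_\lambda)$ its spectrum. *)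

(* Defs.v *)
From HB Require Import structures.
From mathcomp Require Import all_boot all_order all_algebra.
From mathcomp Require Import all_classical all_reals all_analysis.
From mathcomp Require Export complex.

Set Implicit Arguments.
Unset Strict Implicit.
Unset Printing Implicit Defensive.

Import Order.TTheory GRing.Theory Num.Theory.
Import numFieldNormedType.Exports.

Local Open Scope classical_set_scope.
Local Open Scope ring_scope.
Local Open Scope complex_scope.

(* Norms over R[i] take their values in R[i]; these are real numbers, and
   [rnorm v] is the norm of [v] as an element of R. *)
Definition rnorm (R : realType) (V : normedZmodType R[i]) (v : V) : R :=
  complex.Re `|v|.

(* Complex sequences indexed by Z.  The regular module R[i]^o is R[i] with its
   vector space structure and topology. *)
Notation cseq R := (int -> R[i]^o).

Definition finsupp (R : realType) : {pred cseq R} :=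
  fun x => `[< finite_set [set j | x j != 0] >].

Lemma finsupp_submod_closed (R : realType) : submod_closed (@finsupp R).
Proof.
split=> [|a x y /asboolP fx /asboolP fy]; apply/asboolP.
  by rewrite (_ : [set _ | _] = set0)// -subset0 => j /=; rewrite eqxx.
have : finite_set ([set j | x j != 0] `|` [set j | y j != 0]).
  by rewrite finite_setU.
apply: sub_finite_set => j /=.
have [xj0|] := eqVneq (x j) 0; last by left.
have [yj0|] := eqVneq (y j) 0; last by right.
by rewrite /GRing.add /= /GRing.scale /= xj0 yj0 scaler0 addr0 eqxx.
Qed.

HB.instance Definition _ (R : realType) :=
  GRing.isSubmodClosed.Build R[i] (cseq R) (@finsupp R)
    (@finsupp_submod_closed R).

(* The space S_0 of finitely supported sequences. *)
Record S0 (R : realType) : Type :=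
  MkS0 { S0_val :> cseq R; S0_finsupp : S0_val \in @finsupp R }.

HB.instance Definition _ (R : realType) := [isSub for @S0_val R].
HB.instance Definition _ (R : realType) := [Choice of S0 R by <:].
HB.instance Definition _ (R : realType) := [SubChoice_isSubLmodule of S0 R by <:].

Lemma unit_seq_finsupp (R : realType) (n : int) :
  (fun j => (n == j)%:R : R[i]^o) \in @finsupp R.
Proof.
apply/asboolP; apply: (sub_finite_set _ (finite_set1 n)) => j /=.
by case: (eqVneq n j) => [->//|_]; rewrite mulr0n eqxx.
Qed.

Definition unit_seq (R : realType) (n : int) : S0 R :=
  MkS0 (@unit_seq_finsupp R n).

(* ||x||^p in B^p(C), possibly +oo. *)
Definition Bpow (R : realType) (c : int -> int -> R) (p : R) (x : cseq R) :
    \bar R :=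
  (\esum_(jk in [set: int * int])
     (c jk.1 jk.2 * rnorm (x jk.1 - x jk.2) `^ p)%:E)%E.

Definition Bspace (R : realType) (c : int -> int -> R) (p : R) :
    set (cseq R) :=
  [set x | (Bpow c p x < +oo)%E].

Definition Bnorm (R : realType) (c : int -> int -> R) (p : R) (x : cseq R) : R :=
  fine (Bpow c p x) `^ p^-1.

Definition is_norm (R : realType) (V : lmodType R[i]) (N : V -> R) : Prop :=
  [/\ forall x y, N (x + y) <= N x + N y,
      forall a x, N (a *: x) = rnorm a * N x,
      forall x, 0 <= N x &
      forall x, N x = 0 -> x = 0].

(* [X], with the isometric embedding [iota], is the completion B_0^p(C) of
   (S_0, ||.||); it is determined up to an isometric isomorphism. *)
Definition is_completion (R : realType) (c : int -> int -> R) (p : R)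
    (X : completeNormedModType R[i]) (iota : {linear S0 R -> X}) : Prop :=
  (forall x : S0 R, rnorm (iota x) = Bnorm c p x) /\
  closure (range iota) = setT.

(* An element of the completion is the limit of Cauchy sequences in S_0;
   [coords iota x a] says that one of these also converges to the sequence [a]
   coordinate by coordinate, so that [a] is a realization of [x] as a sequence.
   When the coordinate functionals are continuous on (S_0, ||.||), [a] is
   determined by [x].  Otherwise (e.g. for the nearest neighbour matrix on Z)
   a sequence of S_0 of norm tending to 0 may converge pointwise to a nonzero
   constant, and an element of the completion has several realizations. *)
Definition coords (R : realType) (X : completeNormedModType R[i])
    (iota : {linear S0 R -> X}) (x : X) (a : cseq R) : Prop :=
  exists u : nat -> S0 R,
    (fun n => iota (u n)) @ \oo --> x /\
    forall k, (fun n => S0_val (u n) k) @ \oo --> a k.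

Definition bounded_op (R : realType) (X : normedModType R[i])
    (T : {linear X -> X}) : Prop :=
  exists M : R, forall x, rnorm (T x) <= M * rnorm x.

Definition opnorm (R : realType) (X : normedModType R[i])
    (T : {linear X -> X}) : R :=
  sup [set rnorm (T x) | x in [set x | rnorm x <= 1]].

(* Invertibility is meant in the algebra of bounded operators. *)
Definition spectrum (R : realType) (X : normedModType R[i])
    (T : {linear X -> X}) : set R[i]^o :=
  [set z | ~ exists S : {linear X -> X},
      [/\ bounded_op S, forall x, S (T x - z *: x) = x &
          forall x, T (S x) - z *: S x = x]].

(* [T] is the bounded operator T_lambda; it is unique, S_0 being dense. *)
Definition is_mult_op (R : realType) (X : completeNormedModType R[i])
    (iota : {linear S0 R -> X}) (lam : cseq R) (T : {linear X -> X}) : Prop :=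
  bounded_op T /\
  forall n, T (iota (unit_seq R n)) = lam n *: iota (unit_seq R n).

Definition Mult (R : realType) (X : completeNormedModType R[i])
    (iota : {linear S0 R -> X}) : set (cseq R) :=
  [set lam | exists T : {linear X -> X}, is_mult_op iota lam T].

Definition linfty (R : realType) : set (cseq R) :=
  [set lam | exists M : R, forall j, rnorm (lam j) <= M].

Definition linfty_norm (R : realType) (lam : cseq R) : R :=
  sup (range (fun j => rnorm (lam j))).

Definition inf_abs (R : realType) (lam : cseq R) : R :=
  inf (range (fun j => rnorm (lam j))).

Definition inv_seq (R : realType) (lam : cseq R) : cseq R :=
  fun j => (lam j : R[i])^-1.

(* mu_k^p(lambda), possibly +oo. *)
Definition mu_pow (R : realType) (c : int -> int -> R) (p : R) (lam : cseq R)
    (k : int) : \bar R :=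
  (\esum_(j in [set: int]) (c j k * rnorm (lam j - lam k) `^ p)%:E)%E.

Definition weighted_bound (R : realType) (c : int -> int -> R) (p : R)
    (X : completeNormedModType R[i]) (iota : {linear S0 R -> X}) (lam : cseq R)
    (C : R) : Prop :=
  forall (x : X) (a : cseq R), coords iota x a ->
    (\esum_(k in [set: int]) ((rnorm (a k) `^ p)%:E * mu_pow c p lam k)
       <= (C `^ p * rnorm x `^ p)%:E)%E.

Definition best_const (R : realType) (c : int -> int -> R) (p : R)
    (X : completeNormedModType R[i]) (iota : {linear S0 R -> X}) (lam : cseq R) :
    R :=
  inf [set C : R | 0 < C /\ weighted_bound c p iota lam C].

(* Main.v *)
Require Import Defs.
From HB Require Import structures.
From mathcomp Require Import all_boot all_order all_algebra.
From mathcomp Require Import all_classical all_reals all_analysis.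
From mathcomp Require Import ring.
Import Order.TTheory GRing.Theory Num.Theory.
Import numFieldNormedType.Exports.
Local Open Scope classical_set_scope.
Local Open Scope ring_scope.
Local Open Scope complex_scope.

(** Everything rests on the identity
      (l_j - l_k) x_j = (l_j x_j - l_k x_k) - l_k (x_j - x_k).
    By Minkowski's inequality in the weighted l^p space over pairs (j, k), the
    norm of T_l x and the weighted norm (sum_k |x_k|^p mu_k^p)^(1/p) differ by
    at most |l|_oo |x| for x in S_0; density gives one direction of (1) and one
    half of (2), and Fatou's lemma (which applies to every realization of an
    element of the completion as a sequence) the others.  As
    |1/l_j - 1/l_k| <= d^-2 |l_j - l_k|, the weighted condition passes to 1/l,
    and the spectrum is obtained by applying this to l - z, which has the same
    weights mu_k as l. *)

(** * Real-valued norms, and convergence and closure tested with real radii *)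

Section Rnorm.
Context {R : realType}.

Lemma normr_rnorm (V : normedZmodType R[i]) (v : V) : `|v| = (rnorm v)%:C.
Proof. by rewrite /rnorm RRe_real// normr_real. Qed.

Lemma rnorm_ge0 (V : normedZmodType R[i]) (v : V) : 0 <= rnorm v.
Proof. by rewrite -ler0c -normr_rnorm. Qed.

Lemma rnorm0 (V : normedZmodType R[i]) : rnorm (0 : V) = 0.
Proof. by rewrite /rnorm normr0. Qed.

Lemma rnorm_eq0 (V : normedZmodType R[i]) (v : V) : (rnorm v == 0) = (v == 0).
Proof. by rewrite -[RHS]normr_eq0 normr_rnorm -(inj_eq (@complexI R)). Qed.

Lemma rnorm_gt0 (V : normedZmodType R[i]) (v : V) : (0 < rnorm v) = (v != 0).
Proof. by rewrite lt0r rnorm_eq0 rnorm_ge0 andbT. Qed.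

Lemma ler_rnormD (V : normedZmodType R[i]) (v w : V) :
  rnorm (v + w) <= rnorm v + rnorm w.
Proof. by rewrite -lecR rmorphD/= -!normr_rnorm ler_normD. Qed.

Lemma rnormN (V : normedZmodType R[i]) (v : V) : rnorm (- v) = rnorm v.
Proof. by rewrite /rnorm normrN. Qed.

Lemma rnorm_distC (V : normedZmodType R[i]) (v w : V) :
  rnorm (v - w) = rnorm (w - v).
Proof. by rewrite /rnorm distrC. Qed.

Lemma ler_rnormB (V : normedZmodType R[i]) (v w : V) :
  rnorm (v - w) <= rnorm v + rnorm w.
Proof. by rewrite (le_trans (ler_rnormD _ _ _))// rnormN. Qed.

Lemma rnormZ (V : normedModType R[i]) (a : R[i]) (v : V) :
  rnorm (a *: v) = rnorm a * rnorm v.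
Proof. by apply: (@complexI R); rewrite rmorphM/= -!normr_rnorm normrZ. Qed.

Lemma rnormM (a b : R[i]) : rnorm (a * b) = rnorm a * rnorm b.
Proof. by apply: (@complexI R); rewrite rmorphM/= -!normr_rnorm normrM. Qed.

Lemma rnormV (a : R[i]) : rnorm a^-1 = (rnorm a)^-1.
Proof. by apply: (@complexI R); rewrite fmorphV/= -!normr_rnorm normfV. Qed.

Lemma rnorm_real (r : R) : 0 <= r -> rnorm (r%:C) = r.
Proof. by move=> r0; rewrite /rnorm ger0_norm// ler0c. Qed.

(** Radii in the topology of [V] are positive elements of [R[i]]; these are real, so real radii
    suffice. *)
Lemma cvg_rnormP (V : normedModType R[i]) (u : nat -> V) (v : V) :
  u @ \oo --> v <->
  forall e : R, 0 < e -> \forall n \near \oo, rnorm (v - u n) < e.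
Proof.
split=> [/cvgrPdist_lt uv e e0|uv].
  have /uv : 0 < e%:C by rewrite ltcR.
   apply: filterS => n /=.
  by rewrite normr_rnorm ltcR.
apply/cvgrPdist_lt => e e0.
have er : e = (complex.Re e)%:C by rewrite RRe_real// gtr0_real.
move: e0; rewrite er ltcR => /uv; apply: filterS => n /=.
by rewrite normr_rnorm ltcR.
Qed.

Lemma closure_rnormP (V : normedModType R[i]) (A : set V) (v : V) :
  closure A v <-> forall e : R, 0 < e -> exists2 w, A w & rnorm (v - w) < e.
Proof.
split=> [Av e e0|Av B /nbhs_ballP[e/= e0 vB]].
  have [|w [Aw]] := Av (ball v e%:C).
    by apply: nbhsx_ballx; rewrite ltcR.
  by rewrite -ball_normE/= normr_rnorm ltcR; exists w.
have er : e = (complex.Re e)%:C by rewrite RRe_real// gtr0_real.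
move: e0; rewrite er ltcR => /Av[w Aw vw]; exists w; split=> //.
by apply: vB; rewrite -ball_normE/= er normr_rnorm ltcR.
Qed.

Lemma cvg_rnorm (V : normedModType R[i]) (u : nat -> V) (v : V) :
  u @ \oo --> v -> (fun n => rnorm (u n)) @ \oo --> rnorm v.
Proof.
move=> /cvg_rnormP uv; apply/cvgrPdist_lt => e /uv.
apply: filterS => n /(le_lt_trans _); apply.
have /= h1 := ler_rnormD V (v - u n) (u n).
have /= h2 := ler_rnormD V (u n - v) v.
rewrite rnorm_distC !subrK in h1 h2 *; rewrite ler_norml; apply/andP; split.
  by rewrite lerNl opprB lerBlDr.
by rewrite lerBlDr (le_trans h1)// rnorm_distC.
Qed.

End Rnorm.

(** * Powers and sums of nonnegative families: scaling, Minkowski, Fatou *)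

Section Esum.
Context {R : realType}.

(** Finite partial sums give the inequality from left to right for every factor; applied to the
    factor [r^-1] it gives the converse. *)
Lemma ge0_esumZl (T : choiceType) (I : set T) (a : T -> \bar R) (r : R) :
  0 <= r -> (forall i, I i -> 0 <= a i)%E ->
  (\esum_(i in I) (r%:E * a i) = r%:E * \esum_(i in I) a i)%E.
Proof.
move=> r0 a0.
have esumZ_le (s : R) (b : T -> \bar R) : 0 <= s ->
    (forall i, I i -> 0 <= b i)%E ->
    (\esum_(i in I) (s%:E * b i) <= s%:E * \esum_(i in I) b i)%E.
  move=> s0 b0; apply: ge_ereal_sup => /= _ [X [finX XI]] <-.
  rewrite fsbig_finite//= big_seq -ge0_sume_distrr; last first.
    by move=> i; rewrite in_fset_set// inE => /XI; exact: b0.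
  rewrite lee_wpmul2l ?lee_fin// -big_seq -fsbig_finite//.
  by apply: ereal_sup_ubound; exists X.
have [->|rN0] := eqVneq r 0.
  by rewrite mul0e esum1// => i _; rewrite mul0e.
have rgt0 : 0 < r by rewrite lt0r rN0.
apply/eqP; rewrite eq_le esumZ_le//=.
rewrite -lee_pdivlMl//.
rewrite (le_trans _ (esumZ_le _ _ _ _))// ?invr_ge0//.
  by apply: le_esum => i Ii; rewrite muleA -EFinM mulVf// mul1e.
by move=> i Ii; rewrite mule_ge0 ?lee_fin ?a0.
Qed.

(** At a positive limit the power is eventually [expR (p * ln (u n))], and continuity applies. At
    the limit 0, the power is less than [e] once [u n] is less than the [p]-th root of [e]. *)
Lemma cvg_powR (p x : R) (u : nat -> R) : 0 < p ->
  (forall n, 0 <= u n) -> u @ \oo --> x ->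
  (fun n => u n `^ p) @ \oo --> x `^ p.
Proof.
move=> p0 u0 ux.
have x0 : 0 <= x.
  by apply: (cvgr_to_ge ux); exact: nearW.
have [x0'|xpos] := eqVneq x 0.
  rewrite x0' in ux *; rewrite powR0 ?gt_eqF//; apply/cvgrPdist_lt => e e0.
  have ep0 : 0 < e `^ p^-1 by rewrite powR_gt0.
  move/cvgrPdist_lt : ux => /(_ _ ep0); apply: filterS => n /=.
  rewrite !sub0r !normrN !ger0_norm ?powR_ge0// => une.
  have := @gt0_ltr_powR _ p p0 (u n) (e `^ p^-1).
  rewrite !nnegrE u0 (ltW ep0) => /(_ isT isT une).
  by rewrite -powRrM mulVf ?gt_eqF// powRr1// ltW.
have {xpos}x0 : 0 < x by rewrite lt0r xpos.
have lnux : (fun n => expR (p * ln (u n))) @ \oo --> expR (p * ln x).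
  apply: (continuous_cvg _ (@continuous_expR R _)).
  apply: cvgM; first exact: cvg_cst.
  exact: (continuous_cvg _ (continuous_ln x0)).
rewrite {2}/powR gt_eqF//; apply: cvg_trans lnux; apply: near_eq_cvg.
move/cvgrPdist_lt : ux => /(_ _ x0); apply: filterS => n /= xun.
rewrite /powR gt_eqF// lt0r u0 andbT; apply: contraTneq xun => ->.
by rewrite subr0 ger0_norm ?ltW// ltxx.
Qed.

(* Convexity of t^p at the convex combination of f/A and g/B with weights
   A/(A+B) and B/(A+B). *)
Lemma powR_add_le (p f g A B : R) : 1 <= p -> 0 <= f -> 0 <= g ->
  0 < A -> 0 < B ->
  (f + g) `^ p <=
  (A + B) `^ p * (A / (A + B) / A `^ p * f `^ p +
                  B / (A + B) / B `^ p * g `^ p).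
Proof.
move=> p1 f0 g0 A0 B0.
have AB0 : 0 < A + B by rewrite addr_gt0.
have t0 : 0 <= A / (A + B) by rewrite divr_ge0// ltW.
have t1 : A / (A + B) <= 1 by rewrite ler_pdivrMr// mul1r lerDl ltW.
have -> : f + g =
    (A + B) * (A / (A + B) * (f / A) + B / (A + B) * (g / B)).
  by field; rewrite !gt_eqF.
rewrite powRM ?(ltW AB0)//; last first.
  by rewrite addr_ge0// !mulr_ge0 ?invr_ge0 ?(ltW A0) ?(ltW B0) ?(ltW AB0).
rewrite ler_wpM2l ?powR_ge0//.
have := @convex_powR R p p1 (Itv01 t0 t1) (f / A) (g / B).
rewrite convRE [X in X `^ _ <= _]convRE/= /unstable.onem.
rewrite !inE/= !in_itv/= !andbT.
rewrite !divr_ge0 ?(ltW A0) ?(ltW B0)// => /(_ isT isT).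
have -> : 1 - A / (A + B) = B / (A + B) by field; rewrite gt_eqF.
move=> /le_trans; apply.
have powRV (a : R) : 0 < a -> a^-1 `^ p = (a `^ p)^-1.
  by move=> a0; rewrite -powR_inv1 ?(ltW a0)// -powRrM mulN1r powRN.
rewrite !powRM ?invr_ge0 ?(ltW A0) ?(ltW B0)// !powRV//.
by rewrite !mulrA [in leRHS]mulrAC [X in _ <= _ + X]mulrAC.
Qed.

(** Sum [powR_add_le] against the weights [w]: the bounds on the sums of [f] and [g] cancel the
    divisions by the powers of [A] and [B], and the convex weights add up to 1. Since [A] and [B]
    are only upper bounds for the two norms, they can always be taken positive. *)
Lemma esum_minkowski (T : choiceType) (p A B : R) (w f g h : T -> R) :
  1 <= p -> 0 < A -> 0 < B ->
  (forall i, 0 <= w i) -> (forall i, 0 <= f i) -> (forall i, 0 <= g i) ->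
  (forall i, 0 <= h i <= f i + g i) ->
  (\esum_(i in [set: T]) (w i * f i `^ p)%:E <= (A `^ p)%:E)%E ->
  (\esum_(i in [set: T]) (w i * g i `^ p)%:E <= (B `^ p)%:E)%E ->
  (\esum_(i in [set: T]) (w i * h i `^ p)%:E <= ((A + B) `^ p)%:E)%E.
Proof.
move=> p1 A0 B0 w0 f0 g0 hfg fA gB.
have AB0 : 0 < A + B by rewrite addr_gt0.
pose a := (A + B) `^ p * (A / (A + B) / A `^ p).
pose b := (A + B) `^ p * (B / (A + B) / B `^ p).
have a0 : 0 <= a by rewrite !mulr_ge0 ?invr_ge0 ?powR_ge0// ltW.
have b0 : 0 <= b by rewrite !mulr_ge0 ?invr_ge0 ?powR_ge0// ltW.
have wp0 (q : T -> R) i : (0 <= (w i * q i `^ p)%:E)%E.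
  by rewrite lee_fin mulr_ge0 ?powR_ge0.
apply: (@le_trans _ _ (\esum_(i in [set: T])
    (a%:E * (w i * f i `^ p)%:E + b%:E * (w i * g i `^ p)%:E))%E).
  apply: le_esum => i _; rewrite -!EFinM -EFinD lee_fin.
  rewrite [leRHS](_ : _ = w i * ((A + B) `^ p *
    (A / (A + B) / A `^ p * f i `^ p + B / (A + B) / B `^ p * g i `^ p))).
    have /andP[h0 hle] := hfg i.
    rewrite ler_wpM2l//.
    apply: le_trans (powR_add_le _ _ _ _ _ p1 (f0 i) (g0 i) A0 B0).
    by rewrite ge0_ler_powR ?nnegrE ?addr_ge0// (le_trans ler01).
  by rewrite /a /b; ring.
rewrite esumD; try by move=> i _; rewrite mule_ge0.
rewrite !ge0_esumZl//.
apply: (@le_trans _ _ (a%:E * (A `^ p)%:E + b%:E * (B `^ p)%:E)%E).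
  by rewrite leeD// lee_wpmul2l// lee_fin.
rewrite -!EFinM -EFinD lee_fin /a /b -!mulrA !mulVf ?gt_eqF ?powR_gt0//.
by rewrite !mulr1 -mulrDr -mulrDl mulfV ?mulr1// gt_eqF.
Qed.

(** Fatou's lemma for the counting measure: each finite partial sum passes to the limit, and [esum]
    is the supremum of these. *)
Lemma esum_fatou (T : choiceType) (w : nat -> T -> R) (v : T -> R)
    (b : nat -> R) (l : R) :
  (forall n i, 0 <= w n i) ->
  (forall i, (fun n => w n i) @ \oo --> v i) ->
  (forall n, \esum_(i in [set: T]) (w n i)%:E <= (b n)%:E)%E ->
  b @ \oo --> l ->
  (\esum_(i in [set: T]) (v i)%:E <= l%:E)%E.
Proof.
move=> w0 wv wb bl; apply: ge_ereal_sup => /= _ [X [finX _]] <-.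
rewrite fsumEFin// lee_fin fsbig_finite//=.
have wvX : (fun n => \sum_(i <- finmap.enum_fset (fset_set X)) w n i) @ \oo -->
    \sum_(i <- finmap.enum_fset (fset_set X)) v i.
  by apply: cvg_big => // -[y z]; exact: add_continuous.
apply: (ler_cvg_to wvX bl); apply: nearW => n.
rewrite -lee_fin -fsbig_finite//= -fsumEFin//.
by apply: le_trans (wb n); apply: ereal_sup_ubound; exists X.
Qed.
End Esum.

(** * Bounded operators and extension from a dense subspace *)

Section Density.
Context {R : realType}.

Lemma bounded_op_cvg (X : normedModType R[i]) (T : {linear X -> X})
    (u : nat -> X) (x : X) :
  bounded_op T -> u @ \oo --> x -> (fun n => T (u n)) @ \oo --> T x.
Proof.
move=> [M TM] /cvg_rnormP ux; apply/cvg_rnormP => e e0.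
(* The constant in [bounded_op] has no prescribed sign; this replaces it by a positive one. *)
have M1 : 0 < `|M| + 1 by rewrite ltr_wpDl.
have /ux : 0 < e / (`|M| + 1) by rewrite divr_gt0.
apply: filterS => n; rewrite ltr_pdivlMr// mulrC; apply: le_lt_trans.
rewrite -raddfB (le_trans (TM _))// ler_wpM2r ?rnorm_ge0//.
by rewrite (le_trans (ler_norm M))// lerDl.
Qed.

Lemma dense_seq (V : Type) (X : normedModType R[i]) (f : V -> X) (x : X) :
  closure (range f) = setT ->
  exists u : nat -> V, (fun n => f (u n)) @ \oo --> x.
Proof.
move=> fd; have fx : closure (range f) x by rewrite fd.
have /choice[u ux] (n : nat) : exists v, rnorm (x - f v) < n.+1%:R^-1.
  have /closure_rnormP/(_ n.+1%:R^-1) := fx.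
  by rewrite invr_gt0 ltr0Sn => /(_ isT)[_ [v _ <-]]; exists v.
exists u; apply/cvg_rnormP => e e0; near=> n.
by apply: (lt_trans (ux n)); near: n; exact: near_infty_natSinv_lt (PosNum e0).
Unshelve. all: by end_near. Qed.

Lemma dense_ext_eq (V : Type) (X : normedModType R[i]) (f : V -> X)
    (g h : X -> X) : closure (range f) = setT ->
  (forall u x, u @ \oo --> x -> (fun n : nat => g (u n)) @ \oo --> g x) ->
  (forall u x, u @ \oo --> x -> (fun n : nat => h (u n)) @ \oo --> h x) ->
  (forall v, g (f v) = h (f v)) -> forall x, g x = h x.
Proof.
move=> fd gc hc gh x; have [u ux] := dense_seq _ _ _ x fd.
have := hc _ _ ux; under eq_fun do rewrite -gh.
exact: (@cvg_unique _ (@norm_hausdorff _ X) _ _ _ _ (gc _ _ ux)).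
Qed.

Lemma dense_ext_le (V : Type) (X : normedModType R[i]) (f : V -> X)
    (T : {linear X -> X}) (M : R) : closure (range f) = setT ->
  bounded_op T -> (forall v, rnorm (T (f v)) <= M * rnorm (f v)) ->
  forall x, rnorm (T x) <= M * rnorm x.
Proof.
move=> fd Tb TM x; have [u ux] := dense_seq _ _ _ x fd.
apply: (@ler_cvg_to _ \oo _ _ (fun n => rnorm (T (f (u n))))
  (fun n => M * rnorm (f (u n)))).
- exact/cvg_rnorm/bounded_op_cvg.
- by apply: cvgM; [exact: cvg_cst|exact: cvg_rnorm].
- exact: nearW.
Qed.

(** The value at [x] is the limit of [L] along a sequence whose image under [f] tends to [x]. The
    bound makes these values Cauchy and the limit independent of the sequence; linearity and the
    bound then pass to the limit. *)
Lemma dense_extension (V : lmodType R[i]) (X Y : completeNormedModType R[i])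
    (f : {linear V -> X}) (L : {linear V -> Y}) (M : R) :
  closure (range f) = setT -> 0 <= M ->
  (forall v, rnorm (L v) <= M * rnorm (f v)) ->
  exists T : {linear X -> Y}, (forall v, T (f v) = L v) /\
    forall x, rnorm (T x) <= M * rnorm x.
Proof.
move=> fd M0 LM; have M1 : 0 < M + 1 by rewrite ltr_wpDl.
have Lcvg (u : nat -> V) (x : X) : (fun n : nat => f (u n)) @ \oo --> x ->
    cvg ((fun n => L (u n)) @ \oo).
  move=> /(cvg_rnormP X) fu; apply: cauchy_cvg; apply: cauchy_exP => e e0.
  have er : e = (complex.Re e)%:C by rewrite RRe_real// gtr0_real.
  move: e0; rewrite er ltcR => e0.
  (* Two terms each this close to [x] differ by less than [e / (M + 1)], hence their images by less
     than [e]; adding 1 covers [M = 0]. *)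
  have e2 : 0 < complex.Re e / (M + 1) / 2 by rewrite !divr_gt0.
  have [N _ fuN] := fu _ e2; exists (L (u N)); exists N => // n /= Nn.
  rewrite -ball_normE/= normr_rnorm ltcR -raddfB (le_lt_trans (LM _))//.
  have h1 := fuN N (leqnn N); have h2 := fuN n Nn; rewrite /= in h1 h2.
  have : rnorm (f (u N - u n)) < complex.Re e / (M + 1).
    rewrite raddfB (_ : _ - _ = (x - f (u n)) - (x - f (u N))); last first.
      by rewrite opprB [RHS]addrC addrA subrK.
    by rewrite (le_lt_trans (ler_rnormB _ _ _))// (splitr (_ / _)) ltrD.
  rewrite ltr_pdivlMr// mulrC; apply: le_lt_trans.
  by rewrite ler_wpM2r ?rnorm_ge0// lerDl.
have /choice[s sx] (x : X) :
    exists u : nat -> V, (fun n => f (u n)) @ \oo --> x.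
  exact: dense_seq.
pose T0 (x : X) : Y := lim ((fun n => L (s x n)) @ \oo).
(* [T0] is defined through the chosen sequence [s x]; any other one gives the same limit, because
   [L] tends to 0 along the difference. *)
have T0P (x : X) (u : nat -> V) : (fun n : nat => f (u n)) @ \oo --> x ->
    (fun n => L (u n)) @ \oo --> T0 x.
  move=> fu.
  have Ls : (fun n => L (s x n)) @ \oo --> T0 x by exact: Lcvg _ _ (sx x).
  have : (fun n => L (u n - s x n)) @ \oo --> 0.
    have /(cvg_rnormP X) d0 : (fun n => f (u n - s x n)) @ \oo --> 0.
      rewrite -(subrr x); apply: cvg_trans (cvgB fu (sx x)).
      by apply: near_eq_cvg; apply: nearW => n /=; rewrite raddfB.
    apply/(cvg_rnormP Y) => e e0.
    have /d0 : 0 < e / (M + 1) by rewrite divr_gt0.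
    apply: filterS => n; rewrite !sub0r !rnormN ltr_pdivlMr// mulrC.
    apply: le_lt_trans; rewrite (le_trans (LM _))//.
    by rewrite ler_wpM2r ?rnorm_ge0// lerDl.
  move=> d0; rewrite -[T0 x]addr0; apply: cvg_trans (cvgD Ls d0).
  apply: near_eq_cvg; apply: nearW => n.
  by rewrite addrfctE/= raddfB addrC subrK.
have T0lin : linear T0.
  move=> a x y.
  have h : (fun n => f (a *: s x n + s y n)) @ \oo --> a *: x + y.
    apply: cvg_trans (cvgD (cvgZl_tmp (k := a) (sx x)) (sx y)).
    by apply: near_eq_cvg; apply: nearW => n; rewrite addrfctE/= linearP.
  apply: (@cvg_unique _ (@norm_hausdorff _ Y) _ _ _ _ (T0P _ _ h)).
  apply: cvg_trans
    (cvgD (cvgZl_tmp (k := a) (T0P _ _ (sx x))) (T0P _ _ (sx y))).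
  by apply: near_eq_cvg; apply: nearW => n; rewrite addrfctE/= linearP.
pose Tm := GRing.isLinear.Build _ _ _ _ T0 T0lin.
pose T : {linear X -> Y} := HB.pack T0 Tm.
exists T; split=> [v|x] /=.
  apply: (@cvg_unique _ (@norm_hausdorff _ Y) _ _ _ _ (T0P _ (fun=> v) _));
    exact: cvg_cst.
apply: (@ler_cvg_to _ \oo _ _ (fun n => rnorm (L (s x n)))
  (fun n => M * rnorm (f (s x n)))).
- exact/cvg_rnorm/T0P.
- by apply: cvgM; [exact: cvg_cst|exact: cvg_rnorm].
- exact: nearW.
Qed.

End Density.

(** * The operator norm *)

Section Opnorm.
Context {R : realType} {X : normedModType R[i]}.
Implicit Type T : {linear X -> X}.

(** [sup] takes a default value on empty or unbounded sets; for a bounded operator neither case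
    occurs. *)
Lemma opnorm_has_sup T : bounded_op T ->
  has_sup [set rnorm (T x) | x in [set x | rnorm x <= 1]].
Proof.
move=> [M TM]; split; first by exists (rnorm (T 0)), 0 => //=; rewrite rnorm0.
exists `|M| => _ [x /= x1 <-]; rewrite (le_trans (TM x))//.
rewrite (@le_trans _ _ (`|M| * rnorm x))//.
  by rewrite ler_wpM2r ?rnorm_ge0// ler_norm.
by rewrite ler_piMr.
Qed.

Lemma opnorm_ge0 T : bounded_op T -> 0 <= opnorm T.
Proof.
move=> Tb; rewrite -[0](rnorm0 X) -(raddf0 T).
by apply: (ub_le_sup (opnorm_has_sup _ Tb).2); exists 0 => //=; rewrite rnorm0.
Qed.

Lemma ler_opnorm T x : bounded_op T -> rnorm (T x) <= opnorm T * rnorm x.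
Proof.
move=> Tb; have [->|x0] := eqVneq x 0; first by rewrite raddf0 !rnorm0 mulr0.
have nx0 : 0 < rnorm x by rewrite rnorm_gt0.
rewrite -ler_pdivrMr//.
apply: (ub_le_sup (opnorm_has_sup _ Tb).2).
exists ((rnorm x)^-1%:C *: x) => /=.
  by rewrite rnormZ rnorm_real ?invr_ge0 ?rnorm_ge0// mulVf// gt_eqF.
by rewrite linearZ/= rnormZ rnorm_real ?invr_ge0 ?rnorm_ge0// mulrC.
Qed.

Lemma opnorm_le T (M : R) : 0 <= M -> (forall x, rnorm (T x) <= M * rnorm x) ->
  opnorm T <= M.
Proof.
move=> M0 TM; apply: ge_sup.
  by exists (rnorm (T 0)), 0 => //=; rewrite rnorm0.
by move=> _ [x /= x1 <-]; rewrite (le_trans (TM x))// ler_piMr.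
Qed.

End Opnorm.

(** * Supremum and infimum of the moduli of a sequence *)

Section SupNorm.
Context {R : realType}.
Implicit Type lam : cseq R.

Lemma le_linfty_norm lam j : linfty lam -> rnorm (lam j) <= linfty_norm lam.
Proof.
move=> [M lamM]; apply: ub_le_sup; last by exists j.
by exists M => _ [i _ <-].
Qed.

Lemma linfty_norm_ge0 lam : linfty lam -> 0 <= linfty_norm lam.
Proof. by move/(le_linfty_norm lam 0); apply: le_trans; exact: rnorm_ge0. Qed.

Lemma linfty_norm_le lam (M : R) :
  (forall j, rnorm (lam j) <= M) -> linfty_norm lam <= M.
Proof.
move=> lamM; apply: ge_sup; first by exists (rnorm (lam 0)), 0.
by move=> _ [j _ <-].
Qed.

Lemma inf_abs_le lam j : inf_abs lam <= rnorm (lam j).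
Proof.
by apply: ge_inf; [exists 0 => _ [i _ <-]; exact: rnorm_ge0|exists j].
Qed.

Lemma le_inf_abs lam (d : R) :
  (forall j, d <= rnorm (lam j)) -> d <= inf_abs lam.
Proof.
move=> dlam; apply: lb_le_inf; first by exists (rnorm (lam 0)), 0.
by move=> _ [j _ <-].
Qed.

End SupNorm.

(** * Multiplication by a sequence on S_0, and the weighted sum *)

Section Multiplication.
Context {R : realType}.
Implicit Types (lam a : cseq R) (u : S0 R).

Lemma mul_seq_finsupp lam u : (fun j => lam j *: S0_val u j) \in @finsupp R.
Proof.
have /asboolP fu := S0_finsupp u; apply/asboolP.
by apply: sub_finite_set fu => j /=; apply: contra_neq => ->; rewrite scaler0.
Qed.

Definition mul_seq lam u : S0 R := MkS0 (mul_seq_finsupp lam u).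

Lemma mul_seq_is_linear lam : linear (mul_seq lam).
Proof.
move=> b u v; apply: val_inj; apply/funext => j /=.
rewrite /= /GRing.add /= /GRing.scale /=.
by rewrite /GRing.scale /= mulrDr mulrCA.
Qed.

HB.instance Definition _ lam :=
  GRing.isLinear.Build _ _ _ _ (mul_seq lam) (mul_seq_is_linear lam).

Lemma S0_sum_unit_seq u : exists s : seq int,
  u = \sum_(n <- s) S0_val u n *: unit_seq R n.
Proof.
have /asboolP fu := S0_finsupp u.
pose s := finmap.enum_fset (fset_set [set j | S0_val u j != 0]).
exists s; apply: val_inj.
rewrite [RHS]raddf_sum fct_sumE; apply/funext => j /=.
have [js|/negP js] := boolP (j \in s).
  rewrite (bigD1_seq j) ?finmap.fset_uniq//= /GRing.scale/= eqxx /GRing.scale/=.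
  rewrite mulr1 big1 ?addr0// => n nj.
  by rewrite /GRing.scale/= (negbTE nj) mulr0n /GRing.scale/= mulr0.
have -> : S0_val u j = 0.
  apply/eqP/negPn/negP => uj; apply: js.
  by rewrite in_fset_set// inE.
rewrite big_seq big1// => n ns; rewrite /GRing.scale/=.
case: (eqVneq n j) => [nj|_]; first by rewrite -nj in js.
by rewrite mulr0n /GRing.scale/= mulr0.
Qed.

Lemma mul_seq_unit_seq lam n :
  mul_seq lam (unit_seq R n) = lam n *: unit_seq R n.
Proof.
apply: val_inj; apply/funext => j /=; rewrite /GRing.scale /=.
by case: (eqVneq n j) => [->|_]//; rewrite mulr0n mulr0 scaler0.
Qed.

(** The unit sequences span S_0, so the values of [T] on them determine it there by linearity. *)
Lemma mult_op_mul_seq (X : completeNormedModType R[i])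
    (iota : {linear S0 R -> X})
    lam (T : {linear X -> X}) u :
  is_mult_op iota lam T -> T (iota u) = iota (mul_seq lam u).
Proof.
move=> [_ Te]; have [s ->] := S0_sum_unit_seq u.
rewrite !linear_sum; apply: eq_bigr => n _.
by rewrite !linearZ/= mul_seq_unit_seq Te; congr (_ *: _); rewrite linearZ.
Qed.

Lemma unit_seq_neq0 n : unit_seq R n != 0.
Proof.
apply/eqP => /(congr1 (fun u : S0 R => S0_val u n))/eqP.
by rewrite /= eqxx oner_eq0.
Qed.

(** Tonelli's theorem and the symmetry of [c]. The right-hand side is the p-th power of a weighted
    l^p norm over pairs, the form in which Minkowski's inequality applies. *)
Lemma weighted_sumE (c : int -> int -> R) (p : R) lam a :
  (forall j k, c j k = c k j) -> (forall j k, 0 <= c j k) ->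
  (\esum_(k in [set: int]) ((rnorm (a k) `^ p)%:E * mu_pow c p lam k) =
   \esum_(jk in [set: int * int])
     (c jk.1 jk.2 *
       (rnorm (lam jk.1 - lam jk.2) * rnorm (a jk.1)) `^ p)%:E)%E.
Proof.
move=> c_sym c_ge0.
have -> : [set: int * int] = [set: int] `*`` (fun=> [set: int]).
  by apply/seteqP; split.
rewrite -(@esum_esum _ _ _ _ _ (fun j k => (c j k *
    (rnorm (lam j - lam k) * rnorm (a j)) `^ p)%:E)); last first.
  by move=> j k _ _; rewrite lee_fin mulr_ge0 ?powR_ge0.
apply: eq_esum => k _; rewrite /mu_pow -ge0_esumZl ?powR_ge0//; last first.
  by move=> j _; rewrite lee_fin mulr_ge0 ?powR_ge0.
apply: eq_esum => j _; rewrite -EFinM powRM ?rnorm_ge0// rnorm_distC c_sym.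
by congr EFin; ring.
Qed.

End Multiplication.

(** * The estimates on S_0 and their passage to the completion *)

Section Multipliers.
Context {R : realType}.
Context (p : R) (c : int -> int -> R) (X : completeNormedModType R[i])
  (iota : {linear S0 R -> X}).
Context (hp : 1 <= p) (c_sym : forall j k, c j k = c k j)
  (c_ge0 : forall j k, 0 <= c j k)
  (S0_sub : forall x : S0 R, Bspace c p x)
  (S0_norm : is_norm (fun x : S0 R => Bnorm c p x))
  (X_compl : is_completion c p iota).
Implicit Types (lam a : cseq R) (u : S0 R).

Local Notation W lam a :=
  (\esum_(k in [set: int]) ((rnorm (a k) `^ p)%:E * mu_pow c p lam k))%E.

Let p_gt0 : 0 < p. Proof. exact: lt_le_trans hp. Qed.

Let iota_dense : closure (range iota) = setT. Proof. by case: X_compl. Qed.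

(** As S_0 lies in B^p, the sum is finite, so [fine] loses nothing and the power [p] undoes the root
    in [Bnorm]. *)
Lemma BpowE u : Bpow c p u = (rnorm (iota u) `^ p)%:E.
Proof.
have [-> _] := X_compl; rewrite /Bnorm -powRrM mulVf ?gt_eqF// powRr1.
  rewrite fineK// ge0_fin_numE; first exact: S0_sub.
  by apply: esum_ge0 => jk _; rewrite lee_fin mulr_ge0 ?powR_ge0.
apply: fine_ge0.
by apply: esum_ge0 => jk _; rewrite lee_fin mulr_ge0 ?powR_ge0.
Qed.

Lemma rnorm_iota_eq0 u : rnorm (iota u) = 0 -> u = 0.
Proof. by have [-> _] := X_compl; case: S0_norm => _ _ _; exact. Qed.

Lemma rnorm_unit_gt0 n : 0 < rnorm (iota (unit_seq R n)).
Proof.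
rewrite lt0r rnorm_ge0 andbT; apply: contra_neq (unit_seq_neq0 n).
exact: rnorm_iota_eq0.
Qed.

Lemma esum_Bpow_scale (L : R) u : 0 < L ->
  (\esum_(jk in [set: int * int])
     (c jk.1 jk.2 * (L * rnorm (S0_val u jk.1 - S0_val u jk.2)) `^ p)%:E
   <= ((L * rnorm (iota u)) `^ p)%:E)%E.
Proof.
move=> L0; rewrite powRM ?rnorm_ge0 ?(ltW L0)//.
rewrite EFinM -BpowE -ge0_esumZl ?powR_ge0//.
  apply: le_esum => jk _; rewrite -EFinM lee_fin powRM ?rnorm_ge0 ?(ltW L0)//.
  by rewrite mulrCA.
by move=> jk _; rewrite lee_fin mulr_ge0 ?powR_ge0.
Qed.

(** Minkowski for l_j x_j - l_k x_k = (l_j - l_k) x_j + l_k (x_j - x_k): the first term is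
    controlled by the weighted sum, the second by [L] times the norm. *)
Lemma mul_seq_le lam (L C : R) u : 0 < L -> 0 < C ->
  (forall j, rnorm (lam j) <= L) ->
  (W lam (S0_val u) <= ((C * rnorm (iota u)) `^ p)%:E)%E ->
  rnorm (iota (mul_seq lam u)) <= (C + L) * rnorm (iota u).
Proof.
move=> L0 C0 lamL; rewrite weighted_sumE// => WC.
(* [esum_minkowski] asks for positive bounds, hence the separate treatment of [u = 0]. *)
have [/eqP/rnorm_iota_eq0 ->|u0] := boolP (rnorm (iota u) == 0).
  by rewrite !raddf0 rnorm0 mulr0.
have {}u0 : 0 < rnorm (iota u) by rewrite lt0r u0 rnorm_ge0.
have H : (rnorm (iota (mul_seq lam u)) `^ p <=
    ((C + L) * rnorm (iota u)) `^ p).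
  rewrite -lee_fin -BpowE mulrDl.
  apply: (esum_minkowski _ p _ _ (fun jk : int * int => c jk.1 jk.2) _ _ _ hp
    (mulr_gt0 C0 u0) (mulr_gt0 L0 u0) _ _ _ _ WC (esum_Bpow_scale _ u L0)).
  - by [].
  - by move=> jk; rewrite mulr_ge0 ?rnorm_ge0.
  - by move=> jk; rewrite mulr_ge0 ?rnorm_ge0// ltW.
  - move=> [j k] /=; rewrite rnorm_ge0/= -rnormM.
    rewrite (_ : _ *: _ - _ *: _ = (lam j - lam k) * S0_val u j
       + lam k * (S0_val u j - S0_val u k)); last first.
      by rewrite /GRing.scale/=; ring.
    rewrite (le_trans (ler_rnormD _ _ _))// lerD2l rnormM.
    by rewrite ler_wpM2r ?rnorm_ge0.
rewrite leNgt; apply/negP => lt_u; move: H; apply/negP; rewrite -ltNge.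
by rewrite gt0_ltr_powR ?nnegrE ?rnorm_ge0// mulr_ge0 ?rnorm_ge0 ?addr_ge0 ?ltW.
Qed.

(** The same identity solved for (l_j - l_k) x_j, with the roles of the weighted sum and of the norm
    of the product exchanged. *)
Lemma weighted_sum_le lam (L M : R) u : 0 < L -> 0 < M ->
  (forall j, rnorm (lam j) <= L) ->
  rnorm (iota (mul_seq lam u)) <= M * rnorm (iota u) ->
  (W lam (S0_val u) <= (((M + L) * rnorm (iota u)) `^ p)%:E)%E.
Proof.
move=> L0 M0 lamL luM; rewrite weighted_sumE//.
have [/eqP/rnorm_iota_eq0 ->|u0] := boolP (rnorm (iota u) == 0).
  rewrite esum1; first by rewrite lee_fin powR_ge0.
  move=> jk _ /=.
  by rewrite rnorm0 mulr0 powR0 ?gt_eqF// mulr0.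
have {}u0 : 0 < rnorm (iota u) by rewrite lt0r u0 rnorm_ge0.
rewrite mulrDl.
apply: (esum_minkowski _ p (M * rnorm (iota u)) (L * rnorm (iota u))
  (fun jk : int * int => c jk.1 jk.2)
  (fun jk : int * int => rnorm (mul_seq lam u jk.1 - mul_seq lam u jk.2))
  (fun jk : int * int => L * rnorm (S0_val u jk.1 - S0_val u jk.2))) => //.
- exact: mulr_gt0.
- exact: mulr_gt0.
- by move=> jk; exact: rnorm_ge0.
- by move=> jk; rewrite mulr_ge0 ?rnorm_ge0// ltW.
- move=> [j k] /=; rewrite mulr_ge0 ?rnorm_ge0//= -rnormM.
  rewrite (_ : _ * _ = (lam j *: S0_val u j - lam k *: S0_val u k)
     - lam k * (S0_val u j - S0_val u k)); last first.
    by rewrite /GRing.scale/=; ring.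
  rewrite (le_trans (ler_rnormB _ _ _))// lerD2l rnormM.
  by rewrite ler_wpM2r ?rnorm_ge0.
- rewrite -/(Bpow c p (mul_seq lam u)) BpowE lee_fin.
  by rewrite ge0_ler_powR ?nnegrE ?rnorm_ge0 ?mulr_ge0 ?rnorm_ge0// ltW.
- exact: esum_Bpow_scale.
Qed.

(** The constant sequence at [u] shows that [u] realizes [iota u]. *)
Lemma weighted_bound_S0 lam (C : R) u : 0 <= C ->
  weighted_bound c p iota lam C ->
  (W lam (S0_val u) <= ((C * rnorm (iota u)) `^ p)%:E)%E.
Proof.
move=> C0 /(_ (iota u) (S0_val u)); rewrite powRM ?rnorm_ge0//; apply.
by exists (fun=> u); split=> [|k]; exact: cvg_cst.
Qed.

Lemma Mult_of_weighted_bound lam (C : R) : linfty lam -> 0 < C ->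
  weighted_bound c p iota lam C -> Mult iota lam.
Proof.
move=> lamb C0 lamC.
(* Adding 1 keeps the bound positive when [lam] is zero; only boundedness is at stake here. *)
have L0 : 0 < linfty_norm lam + 1 by rewrite ltr_wpDl ?linfty_norm_ge0.
have lamL j : rnorm (lam j) <= linfty_norm lam + 1.
  by rewrite (le_trans (le_linfty_norm _ j lamb))// lerDl.
have CL0 : 0 <= C + (linfty_norm lam + 1) by rewrite addr_ge0 ?ltW.
have bound u := mul_seq_le _ _ _ u L0 C0 lamL
  (weighted_bound_S0 _ _ u (ltW C0) lamC).
have [T [TE Tb]] := dense_extension _ _ _ iota
  (iota \o mul_seq lam : {linear _ -> _}) _ iota_dense CL0 bound.
exists T; split=> [|n]; first by exists (C + (linfty_norm lam + 1)).
by rewrite TE/= mul_seq_unit_seq linearZ.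
Qed.

Lemma opnorm_le_weighted_bound lam (C : R) (T : {linear X -> X}) :
  linfty lam -> 0 < C -> weighted_bound c p iota lam C ->
  is_mult_op iota lam T -> opnorm T <= C + linfty_norm lam.
Proof.
(* The estimate on S_0 needs a positive bound for [lam], and [lam] may vanish; an arbitrarily small
   [e] is therefore added to its sup norm. *)
move=> lamb C0 lamC Tlam; apply/ler_addgt0Pr => e e0; rewrite -addrA.
have L0 : 0 < linfty_norm lam + e by rewrite ltr_wpDl ?linfty_norm_ge0.
have lamL j : rnorm (lam j) <= linfty_norm lam + e.
  by rewrite (le_trans (le_linfty_norm _ j lamb))// lerDl ltW.
have CL0 : 0 <= C + (linfty_norm lam + e) by rewrite addr_ge0 ?ltW.
apply: opnorm_le => //; apply: (dense_ext_le _ _ _ _ _ iota_dense) => [|u].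
  by case: Tlam.
rewrite (mult_op_mul_seq _ _ _ _ _ Tlam).
exact: mul_seq_le (weighted_bound_S0 _ _ u (ltW C0) lamC).
Qed.

(** The unit sequences are eigenvectors, and their norms are positive because the seminorm is a norm
    on S_0. *)
Lemma le_opnorm_mult_op lam (T : {linear X -> X}) n :
  is_mult_op iota lam T -> rnorm (lam n) <= opnorm T.
Proof.
move=> [Tb Te]; rewrite -(ler_pM2r (rnorm_unit_gt0 n)) -rnormZ -Te.
exact: ler_opnorm.
Qed.

Lemma linfty_mult_op lam (T : {linear X -> X}) :
  is_mult_op iota lam T -> linfty lam.
Proof. by move=> Tlam; exists (opnorm T) => n; exact: le_opnorm_mult_op. Qed.

(** Fatou's lemma along a sequence of S_0 that converges both in norm to [x] and coordinatewise to
    [a]; hence every realization [a] is covered, even where [x] has several. *)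
Lemma weighted_bound_mult_op lam (T : {linear X -> X}) (C : R) :
  is_mult_op iota lam T -> opnorm T + linfty_norm lam < C ->
  weighted_bound c p iota lam C.
Proof.
move=> Tlam TC x a [u [ux ua]].
have lamb := linfty_mult_op _ _ Tlam.
have Tb : bounded_op T by case: Tlam.
(* Half of the slack goes to each of the two bounds, which makes both positive. *)
pose e := (C - (opnorm T + linfty_norm lam)) / 2.
have e0 : 0 < e by rewrite divr_gt0// subr_gt0.
have M0 : 0 < opnorm T + e by rewrite ltr_wpDl ?opnorm_ge0.
have L0 : 0 < linfty_norm lam + e by rewrite ltr_wpDl ?linfty_norm_ge0.
have CE : C = (opnorm T + e) + (linfty_norm lam + e).
  by rewrite addrACA /e -splitr addrC subrK.
have C0 : 0 < C by rewrite CE addr_gt0.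
rewrite weighted_sumE// -powRM ?rnorm_ge0 ?(ltW C0)//.
apply: (esum_fatou _ (fun n (jk : int * int) => c jk.1 jk.2 *
  (rnorm (lam jk.1 - lam jk.2) * rnorm (S0_val (u n) jk.1)) `^ p) _
  (fun n => (C * rnorm (iota (u n))) `^ p)).
- by move=> n jk; rewrite mulr_ge0 ?powR_ge0.
- move=> jk; apply: cvgM; first exact: cvg_cst.
  apply: cvg_powR => //; first by move=> n; rewrite mulr_ge0 ?rnorm_ge0.
  apply: cvgM; first exact: cvg_cst.
  exact: cvg_rnorm (ua jk.1).
- move=> n; rewrite -weighted_sumE// CE; apply: weighted_sum_le => //.
    by move=> j; rewrite (le_trans (le_linfty_norm _ j lamb))// lerDl ltW.
  rewrite -(mult_op_mul_seq _ _ _ _ _ Tlam) (le_trans (ler_opnorm _ _ Tb))//.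
  by rewrite ler_wpM2r ?rnorm_ge0// lerDl ltW.
- apply: cvg_powR => //; first by move=> n; rewrite mulr_ge0 ?rnorm_ge0 ?ltW.
  by apply: cvgM; [exact: cvg_cst|exact: cvg_rnorm].
Qed.

(** * Reciprocals of multipliers and the spectrum *)

Lemma linfty_inv_seq lam : 0 < inf_abs lam -> linfty (inv_seq lam).
Proof.
move=> d0; exists (inf_abs lam)^-1 => j; rewrite /inv_seq rnormV.
by rewrite lef_pV2 ?posrE ?inf_abs_le// (lt_le_trans d0)// inf_abs_le.
Qed.

Lemma weighted_bound_inv_seq lam (C : R) : 0 < inf_abs lam -> 0 <= C ->
  weighted_bound c p iota lam C ->
  weighted_bound c p iota (inv_seq lam) (inf_abs lam ^- 2 * C).
Proof.
move=> d0 C0 lamC x a xa; have := lamC x a xa; rewrite !weighted_sumE// => H.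
have i0 : 0 <= inf_abs lam ^- 2 by rewrite invr_ge0 exprn_ge0 ?ltW.
have lam0 j : 0 < rnorm (lam j) by rewrite (lt_le_trans d0)// inf_abs_le.
rewrite powRM// -mulrA EFinM.
apply: le_trans (lee_wpmul2l _ H); last by rewrite lee_fin powR_ge0.
rewrite -ge0_esumZl ?powR_ge0//; last first.
  by move=> jk _; rewrite lee_fin mulr_ge0 ?powR_ge0.
apply: le_esum => -[j k] _ /=; rewrite -EFinM lee_fin mulrCA.
rewrite ler_wpM2l// -powRM ?mulr_ge0 ?rnorm_ge0//.
rewrite ge0_ler_powR ?(ltW p_gt0) ?nnegrE ?mulr_ge0 ?rnorm_ge0// mulrA.
rewrite ler_wpM2r ?rnorm_ge0//.
have -> : inv_seq lam j - inv_seq lam k =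
    ((lam j : R[i])^-1 * (lam k : R[i])^-1) * (lam k - lam j) :> R[i].
  rewrite /inv_seq; field.
  by rewrite -!rnorm_eq0 !gt_eqF.
rewrite !rnormM !rnormV rnorm_distC ler_wpM2r ?rnorm_ge0//.
rewrite -exprVn expr2 ler_pM ?invr_ge0 ?rnorm_ge0//.
  by rewrite lef_pV2 ?posrE ?inf_abs_le.
by rewrite lef_pV2 ?posrE ?inf_abs_le.
Qed.

Lemma Mult_inv_seq lam : Mult iota lam -> 0 < inf_abs lam ->
  Mult iota (inv_seq lam).
Proof.
move=> [T Tlam] d0.
have lamb := linfty_mult_op _ _ Tlam.
have Tb : bounded_op T by case: Tlam.
pose C := opnorm T + linfty_norm lam + 1.
have C0 : 0 < C by rewrite ltr_wpDl// addr_ge0 ?opnorm_ge0 ?linfty_norm_ge0.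
apply: (Mult_of_weighted_bound _ (inf_abs lam ^- 2 * C)).
- exact: linfty_inv_seq.
- by rewrite mulr_gt0// invr_gt0 exprn_gt0.
- apply: weighted_bound_inv_seq (ltW C0) _ => //.
  by apply: weighted_bound_mult_op Tlam _; rewrite ltrDl.
Qed.

Lemma opnorm_inv_seq lam (T S : {linear X -> X}) : 0 < inf_abs lam ->
  is_mult_op iota lam T -> is_mult_op iota (inv_seq lam) S ->
  opnorm S <= inf_abs lam ^- 2 * (opnorm T + linfty_norm lam) + (inf_abs lam)^-1.
Proof.
move=> d0 Tlam Slam.
have lamb := linfty_mult_op _ _ Tlam.
have Tb : bounded_op T by case: Tlam.
have i0 : 0 < inf_abs lam ^- 2 by rewrite invr_gt0 exprn_gt0.
apply/ler_addgt0Pr => e e0.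
(* The excess is scaled so that it becomes exactly [e] when the reciprocal multiplies the constant
   by [inf_abs lam ^- 2]. *)
pose C := opnorm T + linfty_norm lam + e / inf_abs lam ^- 2.
have e'0 : 0 < e / inf_abs lam ^- 2 by rewrite divr_gt0.
have C0 : 0 < C by rewrite ltr_wpDl// addr_ge0 ?opnorm_ge0 ?linfty_norm_ge0.
have lamC : weighted_bound c p iota lam C.
  by apply: weighted_bound_mult_op Tlam _; rewrite ltrDl.
have := opnorm_le_weighted_bound _ _ S (linfty_inv_seq _ d0) (mulr_gt0 i0 C0)
  (weighted_bound_inv_seq _ _ d0 (ltW C0) lamC) Slam.
move=> /le_trans; apply.
have -> : inf_abs lam ^- 2 * C =
    inf_abs lam ^- 2 * (opnorm T + linfty_norm lam) + e.
  by rewrite /C mulrDr; congr (_ + _); rewrite mulrC divfK ?gt_eqF.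
rewrite addrAC lerD2r lerD2l; apply: linfty_norm_le => j.
rewrite /inv_seq rnormV lef_pV2 ?posrE ?inf_abs_le//.
by rewrite (lt_le_trans d0)// inf_abs_le.
Qed.

Lemma spectrum_mult_op lam (T : {linear X -> X}) : is_mult_op iota lam T ->
  spectrum T = closure (range lam).
Proof.
move=> Tlam.
have lamb := linfty_mult_op _ _ Tlam.
have Tb : bounded_op T by case: Tlam.
(* Points of the closure first. An inverse [S] of T - z with bound [M], applied to the eigenvector
   e_n, would give 1 <= |M| |l_n - z|, which fails for l_n close enough to [z]. *)
apply/seteqP; split=> z; last first.
  move=> /(closure_rnormP R[i]^o) zlam [S [[M SM] ST _]].
  have M1 : 0 < `|M| + 1 by rewrite ltr_wpDl.
  have /zlam[_ [n _ <-]] : 0 < (`|M| + 1)^-1 by rewrite invr_gt0.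
  rewrite rnorm_distC -[_^-1]mul1r ltr_pdivlMr//; apply/negP; rewrite -leNgt.
  rewrite -(ler_pM2r (rnorm_unit_gt0 n)) mul1r -{1}[iota _]ST.
  have [_ ->] := Tlam; rewrite -scalerBl (le_trans (SM _))// rnormZ.
  rewrite [leRHS]mulrAC [leRHS]mulrC ler_wpM2r ?mulr_ge0 ?rnorm_ge0//.
  by rewrite (le_trans (ler_norm M))// lerDl.
(* Off the closure, l - z is bounded away from 0, so the operator of its reciprocal is available as
   a candidate for the inverse of T - z. *)
apply: contra_notP => zlam.
have [e e0 elam] : exists2 e : R, 0 < e & forall n, e <= rnorm (lam n - z).
  apply: contra_notP zlam => /forall2NP h.
  apply/(closure_rnormP R[i]^o) => e e0; have [//|/existsNP[n]] := h e.
  by move=> /negP; rewrite -ltNge rnorm_distC; exists (lam n) => //; exists n.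
pose lamz : cseq R := fun n => lam n - z.
have dlam : 0 < inf_abs lamz by apply: lt_le_trans e0 _; exact: le_inf_abs.
pose C := opnorm T + linfty_norm lam + 1.
have C0 : 0 < C by rewrite ltr_wpDl// addr_ge0 ?opnorm_ge0 ?linfty_norm_ge0.
have lamC : weighted_bound c p iota lam C.
  by apply: weighted_bound_mult_op Tlam _; rewrite ltrDl.
have lamzM : Mult iota lamz.
  apply: (Mult_of_weighted_bound _ C) => //.
    exists (linfty_norm lam + rnorm z) => j.
    by rewrite (le_trans (ler_rnormB _ _ _))// lerD2r le_linfty_norm.
  (* Only differences of [lam] enter the weights, so the shift by [z] leaves them and the constant
     unchanged. *)
  move=> x a /lamC; congr (_ <= _)%E; apply: eq_esum => k _; congr (_ * _)%E.
  apply: eq_esum => j _; rewrite /lamz (_ : lam j - z - _ = lam j - lam k)//.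
  by rewrite opprB addrA subrK.
have [S Slam] := Mult_inv_seq _ lamzM dlam.
have Sb : bounded_op S by case: Slam.
have lamz0 j : lamz j != 0.
  by rewrite -rnorm_gt0 (lt_le_trans dlam)// inf_abs_le.
have TzE u : T (iota u) - z *: iota u = iota (mul_seq lamz u).
  rewrite (mult_op_mul_seq _ _ _ _ _ Tlam) -linearZ -raddfB; congr (iota _).
  apply: val_inj; apply/funext => j /=.
  rewrite /GRing.add /= /GRing.opp /= /GRing.scale /=.
  by rewrite /GRing.scale /= -mulrBl.
have Tzc (u : nat -> X) x : u @ \oo --> x ->
    (fun n => T (u n) - z *: u n) @ \oo --> T x - z *: x.
  by move=> ux; apply: cvgB; [exact: bounded_op_cvg|exact: cvgZl_tmp].
(* Both inverse identities are coordinatewise cancellations on S_0, extended by density and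
   continuity. *)
exists S; split=> //.
- apply: (dense_ext_eq _ _ iota _ idfun iota_dense) => // [u x /Tzc|u /=].
    exact: bounded_op_cvg.
  rewrite TzE (mult_op_mul_seq _ _ _ _ _ Slam); congr (iota _).
  apply: val_inj; apply/funext => j /=; rewrite /inv_seq.
  by rewrite /GRing.scale/= mulKf.
- apply: (dense_ext_eq _ _ iota _ idfun iota_dense) => // [u x ux|u /=].
    by apply: (Tzc (fun n => S (u n))); exact: bounded_op_cvg.
  rewrite (mult_op_mul_seq _ _ _ _ _ Slam) TzE; congr (iota _).
  apply: val_inj; apply/funext => j /=; rewrite /inv_seq.
  by rewrite /GRing.scale/= mulVKf.
Qed.

(** * The characterization of multipliers and the best constant *)

Lemma MultP lam : Mult iota lam <->
  linfty lam /\ exists C : R, 0 < C /\ weighted_bound c p iota lam C.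
Proof.
split=> [[T Tlam]|[lamb [C [C0 lamC]]]]; last first.
  exact: Mult_of_weighted_bound lamC.
have lamb := linfty_mult_op _ _ Tlam; split=> //.
have Tb : bounded_op T by case: Tlam.
exists (opnorm T + linfty_norm lam + 1); split.
  by rewrite ltr_wpDl// addr_ge0 ?opnorm_ge0 ?linfty_norm_ge0.
by apply: weighted_bound_mult_op Tlam _; rewrite ltrDl.
Qed.

Lemma best_const_mult_op lam (T : {linear X -> X}) : is_mult_op iota lam T ->
  best_const c p iota lam - linfty_norm lam <= opnorm T /\
  opnorm T <= best_const c p iota lam + linfty_norm lam.
Proof.
move=> Tlam; have lamb := linfty_mult_op _ _ Tlam.
have Tb : bounded_op T by case: Tlam.
split.
  rewrite lerBlDr; apply/ler_addgt0Pr => e e0; apply: ge_inf.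
    by exists 0 => C [/ltW].
  split; first by rewrite ltr_wpDl// addr_ge0 ?opnorm_ge0 ?linfty_norm_ge0.
  by apply: weighted_bound_mult_op Tlam _; rewrite ltrDl.
(* Every admissible constant bounds [opnorm T - linfty_norm lam] from above. That one exists has to
   be checked, since [inf] of the empty set is only a default value. *)
rewrite -lerBlDr; apply: lb_le_inf.
  have /MultP[_ [C [C0 lamC]]] : Mult iota lam by exists T.
  by exists C.
by move=> C [C0 lamC]; rewrite lerBlDr; exact: opnorm_le_weighted_bound lamC _.
Qed.

End Multipliers.

Theorem lemma2p2 (R : realType) (p : R) (hp : 1 <= p)
  (c : int -> int -> R)
  (c_sym : forall j k, c j k = c k j)
  (c_ge0 : forall j k, 0 <= c j k)
  (c_diag : forall j, c j j = 0)
  (S0_sub : forall x : S0 R, Bspace c p x)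
  (S0_norm : is_norm (fun x : S0 R => Bnorm c p x))
  (X : completeNormedModType R[i]) (iota : {linear S0 R -> X})
  (X_compl : is_completion c p iota) :
  (forall lam : cseq R,
     Mult iota lam <->
     linfty lam /\ exists C : R, 0 < C /\ weighted_bound c p iota lam C) /\
  (forall (lam : cseq R) (T : {linear X -> X}), is_mult_op iota lam T ->
     spectrum T = closure (range lam)) /\
  (forall lam : cseq R, Mult iota lam -> 0 < inf_abs lam ->
     Mult iota (inv_seq lam)) /\
  (forall (lam : cseq R) (T S : {linear X -> X}), 0 < inf_abs lam ->
     is_mult_op iota lam T -> is_mult_op iota (inv_seq lam) S ->
     opnorm S <= (inf_abs lam) ^- 2 * (opnorm T + linfty_norm lam)
                 + (inf_abs lam)^-1) /\
  (forall (lam : cseq R) (T : {linear X -> X}), is_mult_op iota lam T ->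
     best_const c p iota lam - linfty_norm lam <= opnorm T /\
     opnorm T <= best_const c p iota lam + linfty_norm lam).
Proof.
split; first by move=> lam; exact: MultP.
split; first by move=> lam T; exact: (spectrum_mult_op p c).
split; first by move=> lam; exact: (Mult_inv_seq p c).
split; first by move=> lam T S; exact: (opnorm_inv_seq p c).
by move=> lam T; exact: best_const_mult_op.
Qed.
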